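(* Let $n\ge 2$ and let $x=(x_1,\dots,x_n),\ y=(y_1,\dots,y_n)\in\mathbb{R}^n$. (a) For a line $y=mx+b$ ($m,b\in\mathbb{R}$) define $Y_i=|mx_i+b-y_i|$ and $Y(m,b)=\frac1n\sum_{i=1}^n Y_i^2$. Suppose $\operatorname{var}(x)\neq 0$. Then $Y$ has a unique minimum over $(m,b)\in\mathbb{R}^2$, given by $$m=\frac{\operatorname{cov}(x,y)}{\operatorname{var}(x)}=\frac{n\sum_{i=1}^n x_iy_i-\sum_{i=1}^n x_i\sum_{i=1}^n y_i}{n\sum_{i=1}^n x_i^2-\left(\sum_{i=1}^n x_i\right)^2},$$ $$b=\frac{\overline{x^2}\,\overline{y}-\overline{x}\,\overline{xy}}{\operatorname{var}(x)}=\frac{\overline{y}\operatorname{var}(x)-\overline{x}\operatorname{cov}(x,y)}{\operatorname{var}(x)}=\frac{\sum_{i=1}^n x_i^2\sum_{i=1}^n y_i-\sum_{i=1}^n x_i\sum_{i=1}^n x_iy_i}{n\sum_{i=1}^n x_i^2-\left(\sum_{i=1}^n x_i\right)^2}.$$ (b) For a line $x=\mu y+\beta$ ($\mu,\beta\in\mathbb{R}$) define $X_i=|\mu y_i+\beta-x_i|$ and $X(\mu,\beta)=\frac1n\sum_{i=1}^n X_i^2$. Suppose $\operatorname{var}(y)\neq 0$. Then $X$ has a unique minimum over $(\mu,\beta)\in\mathbb{R}^2$, given by $$\mu=\frac{\operatorname{cov}(x,y)}{\operatorname{var}(y)}=\frac{n\sum_{i=1}^n x_iy_i-\sum_{i=1}^n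 x_i\sum_{i=1}^n y_i}{n\sum_{i=1}^n y_i^2-\left(\sum_{i=1}^n y_i\right)^2},$$ $$\beta=\frac{\overline{y^2}\,\overline{x}-\overline{y}\,\overline{xy}}{\operatorname{var}(y)}=\frac{\overline{x}\operatorname{var}(y)-\overline{y}\operatorname{cov}(x,y)}{\operatorname{var}(y)}=\frac{\sum_{i=1}^n y_i^2\sum_{i=1}^n x_i-\sum_{i=1}^n y_i\sum_{i=1}^n x_iy_i}{n\sum_{i=1}^n y_i^2-\left(\sum_{i=1}^n y_i\right)^2}.$$ (c) For a line $x\sin\theta-y\cos\theta=c$ with $-\pi/2<\theta\le\pi/2$ and $c\in\mathbb{R}$, define $D_i=|x_i\sin\theta-y_i\cos\theta-c|$ and $D(\theta,c)=\frac1n\sum_{i=1}^n D_i^2$. The minimum of $D$ over $(\theta,c)\in(-\pi/2,\pi/2]\times\mathbb{R}$ occurs at $c=\overline{x}\sin\theta-\overline{y}\cos\theta$, where $\theta$ is as follows. - If $\operatorname{var}(x)=\operatorname{var}(y)$ and $\operatorname{cov}(x,y)=0$, then all values of $\theta$ (with the corresponding $c$) give the same minimum. - If $\operatorname{var}(x)\ne\operatorname{var}(y)$, then $D$ has a unique minimum, and its $\theta$ satisfies $$\tan(2\theta)=E:=\frac{2\operatorname{cov}(x,y)}{\operatorname{var}(x)-\operatorname{var}(y)}=\frac{2\left(n\sum_{i=1}^n x_iy_i-\sum_{i=1}^n x_i\sum_{i=1}^n y_i\right)}{n\sum_{i=1}^n x_i^2-\left(\sum_{i=1}^n x_i\right)^2-n\sum_{i=1}^n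 y_i^2+\left(\sum_{i=1}^n y_i\right)^2}.$$ More precisely, if $\operatorname{var}(x)>\operatorname{var}(y)$ then $\theta=\frac12\arctan(E)$; if $\operatorname{var}(x)<\operatorname{var}(y)$ then $\theta=\frac12\arctan(E)+\frac{\pi}{2}$ when $\operatorname{cov}(x,y)\ge 0$ and $\theta=\frac12\arctan(E)-\frac{\pi}{2}$ when $\operatorname{cov}(x,y)<0$. - If $\operatorname{var}(x)=\operatorname{var}(y)$, then $\theta=\pi/4$ when $\operatorname{cov}(x,y)>0$ and $\theta=-\pi/4$ when $\operatorname{cov}(x,y)<0$.
   Context: For $x,y\in\mathbb{R}^n$, $n\ge2$: $\overline{x}=\frac1n\sum_{i=1}^n x_i$, $\overline{y}=\frac1n\sum_{i=1}^n y_i$, $\overline{xy}=\frac1n\sum_{i=1}^n x_iy_i$, $\overline{x^2}=\frac1n\sum_{i=1}^n x_i^2$, $\overline{y^2}=\frac1n\sum_{i=1}^n y_i^2$; $\operatorname{cov}(x,y)=\overline{xy}-\overline{x}\,\overline{y}$; $\operatorname{var}(x)=\operatorname{cov}(x,x)=\overline{x^2}-\overline{x}^2$. Here $\arctan$ takes values in $(-\pi/2,\pi/2)$. *)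

(* Defs.v *)
From HB Require Import structures.
From mathcomp Require Import all_boot all_order all_algebra.
From mathcomp Require Import all_classical all_reals all_analysis.

Set Implicit Arguments.
Unset Strict Implicit.
Unset Printing Implicit Defensive.

Import Order.TTheory GRing.Theory Num.Theory.
Import numFieldNormedType.Exports.
Local Open Scope classical_set_scope.
Local Open Scope ring_scope.

Definition mean (R : realType) (n : nat) (x : 'rV[R]_n) : R :=
  n%:R^-1 * \sum_(i < n) x 0 i.

Definition mean_mul (R : realType) (n : nat) (x y : 'rV[R]_n) : R :=
  n%:R^-1 * \sum_(i < n) x 0 i * y 0 i.

Definition mean_sqr (R : realType) (n : nat) (x : 'rV[R]_n) : R :=
  n%:R^-1 * \sum_(i < n) x 0 i ^+ 2.

Definition cov (R : realType) (n : nat) (x y : 'rV[R]_n) : R :=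
  mean_mul x y - mean x * mean y.

Definition var (R : realType) (n : nat) (x : 'rV[R]_n) : R := cov x x.

(* Vertical distance from (x_i, y_i) to the line y = m x + b. *)
Definition vdist (R : realType) (n : nat) (x y : 'rV[R]_n) (m b : R)
    (i : 'I_n) : R :=
  `|m * x 0 i + b - y 0 i|.

Definition vmse (R : realType) (n : nat) (x y : 'rV[R]_n) (p : R * R) : R :=
  n%:R^-1 * \sum_(i < n) vdist x y p.1 p.2 i ^+ 2.

(* Horizontal distance from (x_i, y_i) to the line x = mu y + beta. *)
Definition hdist (R : realType) (n : nat) (x y : 'rV[R]_n) (mu beta : R)
    (i : 'I_n) : R :=
  `|mu * y 0 i + beta - x 0 i|.

Definition hmse (R : realType) (n : nat) (x y : 'rV[R]_n) (p : R * R) : R :=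
  n%:R^-1 * \sum_(i < n) hdist x y p.1 p.2 i ^+ 2.

(* Orthogonal distance from (x_i, y_i) to the line
   x sin theta - y cos theta = c. *)
Definition odist (R : realType) (n : nat) (x y : 'rV[R]_n) (theta c : R)
    (i : 'I_n) : R :=
  `|x 0 i * sin theta - y 0 i * cos theta - c|.

Definition omse (R : realType) (n : nat) (x y : 'rV[R]_n) (p : R * R) : R :=
  n%:R^-1 * \sum_(i < n) odist x y p.1 p.2 i ^+ 2.

(* Each line has exactly one pair (theta, c) in this set. *)
Definition line_params (R : realType) : set (R * R) :=
  `]- (pi / 2), pi / 2]%classic `*` setT.
Arguments line_params : clear implicits.

Definition is_min_on (R : realType) (T : Type) (A : set T) (f : T -> R)
    (a : T) : Prop :=
  A a /\ forall b, A b -> f a <= f b.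

Definition is_unique_min_on (R : realType) (T : Type) (A : set T) (f : T -> R)
    (a : T) : Prop :=
  is_min_on A f a /\ forall b, is_min_on A f b -> b = a.

(* Main.v *)
Require Import Defs.
From HB Require Import structures.
From mathcomp Require Import all_boot all_order all_algebra.
From mathcomp Require Import all_classical all_reals all_analysis.
From mathcomp Require Import ring lra.

(** Each of the three mean squared errors is the mean of the squares of an
    affine form [a x_i + b y_i + c], and the bias-variance identity
    [mean_sqr_affine] splits such a mean into a square, the squared value of
    the form at the centroid, plus the quadratic form
    [a^2 var x + 2 a b cov x y + b^2 var y].  The square vanishes exactly for
    the lines through the centroid, which fixes the intercept in terms of the
    slope; the quadratic form is left to be minimised over the slope.

    For vertical distances [(a, b) = (m, -1)], and completing the square in [m]
    gives the regression line; horizontal distances are the same problem with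
    [x] and [y] exchanged.

    For orthogonal distances [(a, b) = (sin theta, - cos theta)], and the
    double angle formulas turn the quadratic form into half of
    [var x + var y - (u cos (2 theta) + v sin (2 theta))], where
    [(u, v) = (var x - var y, 2 cov x y)].  If [(u, v)] has polar coordinates
    [(r, 2 theta0)], then the error at [theta] exceeds the one at [theta0] by
    [r sin^2 (theta - theta0)] ([omse_gap]).  For [r > 0] this makes [theta0]
    the only minimiser, because two parameters in the half-open interval of
    length [pi] differ by less than [pi] ([omse_unique_min]).  It remains to
    halve the polar angle of [(u, v)]: it is [atan (v / u)] for [u > 0],
    differs from that by [pi] for [u < 0], and is [pi / 2] or [- pi / 2] for
    [u = 0]. *)

Set Implicit Arguments.
Unset Strict Implicit.
Unset Printing Implicit Defensive.

Import Order.TTheory GRing.Theory Num.Theory.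
Import numFieldNormedType.Exports.
Local Open Scope classical_set_scope.
Local Open Scope ring_scope.

(** * Unique minimisers *)

(** The unique minimisers below are all recognised in this form: the excess of
    [f] over its value at [a] is an explicit nonnegative expression [g]. *)
Lemma unique_min_on_gap (R : realType) (T : Type) (A : set T) (f g : T -> R)
    (a : T) :
  A a -> (forall b, A b -> f b = f a + g b) -> (forall b, A b -> 0 <= g b) ->
  (forall b, A b -> g b = 0 -> b = a) -> is_unique_min_on A f a.
Proof.
move=> Aa fE g_ge0 g_eq0; split.
  by split=> // b Ab; rewrite (fE b Ab) lerDl g_ge0.
move=> b [Ab b_min]; apply: g_eq0 => //; apply/eqP.
by rewrite eq_le g_ge0 // andbT -(lerD2l (f a)) -fE // addr0 b_min.
Qed.

(** * Second moments *)

Lemma mean_mulC (R : realType) (n : nat) (x y : 'rV[R]_n) :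
  mean_mul x y = mean_mul y x.
Proof. by rewrite /mean_mul; under eq_bigr do rewrite mulrC. Qed.

Lemma covC (R : realType) (n : nat) (x y : 'rV[R]_n) : cov x y = cov y x.
Proof. by rewrite /cov mean_mulC (mulrC (mean x)). Qed.

Lemma varE (R : realType) (n : nat) (x : 'rV[R]_n) :
  var x = mean_sqr x - mean x ^+ 2.
Proof. by []. Qed.

Lemma sqr_card_cov (R : realType) (n : nat) (x y : 'rV[R]_n) : (0 < n)%N ->
  n%:R * (\sum_(i < n) x 0 i * y 0 i)
    - (\sum_(i < n) x 0 i) * (\sum_(i < n) y 0 i) = n%:R ^+ 2 * cov x y.
Proof.
rewrite /cov /mean_mul /mean -(ltr0n R) => /lt0r_neq0 n_neq0.
by field.
Qed.

Lemma sqr_card_var (R : realType) (n : nat) (x : 'rV[R]_n) : (0 < n)%N ->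
  n%:R * (\sum_(i < n) x 0 i ^+ 2) - (\sum_(i < n) x 0 i) ^+ 2
  = n%:R ^+ 2 * var x.
Proof. exact: sqr_card_cov. Qed.

(** Bias-variance decomposition: the square is that of the value at the
    centroid, and the remaining terms are the variance of [a x + b y]. *)
Lemma mean_sqr_affine (R : realType) (n : nat) (x y : 'rV[R]_n) (a b c : R) :
  (0 < n)%N ->
  n%:R^-1 * \sum_(i < n) (a * x 0 i + b * y 0 i + c) ^+ 2 =
  (a * mean x + b * mean y + c) ^+ 2
    + (a ^+ 2 * var x + 2 * a * b * cov x y + b ^+ 2 * var y).
Proof.
rewrite -(ltr0n R) => /lt0r_neq0 n_neq0.
have -> : \sum_(i < n) (a * x 0 i + b * y 0 i + c) ^+ 2 =
    a ^+ 2 * (\sum_(i < n) x 0 i ^+ 2)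
    + 2 * a * b * (\sum_(i < n) x 0 i * y 0 i)
    + b ^+ 2 * (\sum_(i < n) y 0 i ^+ 2)
    + 2 * a * c * (\sum_(i < n) x 0 i) + 2 * b * c * (\sum_(i < n) y 0 i)
    + n%:R * c ^+ 2.
  have -> : n%:R * c ^+ 2 = \sum_(i < n) c ^+ 2.
    by rewrite sumr_const card_ord mulr_natl.
  rewrite !mulr_sumr -!big_split /=; apply: eq_bigr => i _; ring.
rewrite !varE /cov /mean_mul /mean_sqr /mean.
by field.
Qed.

(** The variance is the mean of the squares of [x_i - mean x], a form that
    vanishes at the centroid. *)
Lemma var_ge0 (R : realType) (n : nat) (x : 'rV[R]_n) :
  (0 < n)%N -> 0 <= var x.
Proof.
move=> n_gt0.
have := mean_sqr_affine x x 1 0 (- mean x) n_gt0.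
have -> : (1 * mean x + 0 * mean x + - mean x) ^+ 2
  + (1 ^+ 2 * var x + 2 * 1 * 0 * cov x x + 0 ^+ 2 * var x) = var x by ring.
move=> <-; apply: mulr_ge0; first by rewrite invr_ge0 ler0n.
by apply: sumr_ge0 => i _; apply: sqr_ge0.
Qed.

(** * Vertical distances *)

Lemma vmseE (R : realType) (n : nat) (x y : 'rV[R]_n) (m b : R) : (0 < n)%N ->
  vmse x y (m, b) =
  (m * mean x + b - mean y) ^+ 2 + (m ^+ 2 * var x - 2 * m * cov x y + var y).
Proof.
move=> n_gt0; rewrite /vmse /vdist /=.
have -> : \sum_(i < n) `|m * x 0 i + b - y 0 i| ^+ 2 =
    \sum_(i < n) (m * x 0 i + (-1) * y 0 i + b) ^+ 2.
  by apply: eq_bigr => i _; rewrite real_normK ?num_real //; ring.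
by rewrite mean_sqr_affine //; ring.
Qed.

(** Completing the square in the slope [m]; the coefficient [var x] of that
    square is positive. *)
Lemma vmse_unique_min (R : realType) (n : nat) (x y : 'rV[R]_n) :
  (0 < n)%N -> var x != 0 ->
  is_unique_min_on setT (vmse x y)
    (cov x y / var x, (mean y * var x - mean x * cov x y) / var x).
Proof.
move=> n_gt0 vx_neq0.
have vx_gt0 : 0 < var x by rewrite lt_def vx_neq0 var_ge0.
pose g (p : R * R) := (p.1 * mean x + p.2 - mean y) ^+ 2
  + var x * (p.1 - cov x y / var x) ^+ 2.
apply: (@unique_min_on_gap _ _ _ _ g) => //.
- by move=> [m b] _; rewrite !vmseE // /g /=; field.
- by move=> [m b] _; rewrite addr_ge0 ?sqr_ge0 // mulr_ge0 ?sqr_ge0 // ltW.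
move=> [m b] _ /eqP; rewrite /g /= paddr_eq0 ?sqr_ge0 //; last first.
  by rewrite mulr_ge0 ?sqr_ge0 // ltW.
rewrite sqrf_eq0 mulf_eq0 (negbTE vx_neq0) /= sqrf_eq0 (subr_eq0 m).
move=> /andP[/eqP b_eq /eqP m_eq]; congr (_, _) => //.
have -> : b = mean y - m * mean x by move: b_eq; lra.
by rewrite m_eq; field.
Qed.

(** * Orthogonal distances *)

Lemma omseE (R : realType) (n : nat) (x y : 'rV[R]_n) (t c : R) : (0 < n)%N ->
  omse x y (t, c) =
  (c - (mean x * sin t - mean y * cos t)) ^+ 2
  + (var x + var y
     - ((var x - var y) * cos (2 * t) + 2 * cov x y * sin (2 * t))) / 2.
Proof.
move=> n_gt0; rewrite /omse /odist /=.
have -> : \sum_(i < n) `|x 0 i * sin t - y 0 i * cos t - c| ^+ 2 =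
    \sum_(i < n) (sin t * x 0 i + (- cos t) * y 0 i + (- c)) ^+ 2.
  by apply: eq_bigr => i _; rewrite real_normK ?num_real //; ring.
rewrite mean_sqr_affine // (mulr_natl t) sin_mulr2n cos_mulr2n.
have sin2 := sin2cos2 t.
by field: sin2.
Qed.

(** The polar form of [(var x - var y, 2 cov x y)] turns the sinusoid of
    [omseE] into [r cos (2 (t - t0))], hence the excess into a square. *)
Lemma omse_gap (R : realType) (n : nat) (x y : 'rV[R]_n) (r t0 t c : R) :
  (0 < n)%N ->
  var x - var y = r * cos (2 * t0) -> 2 * cov x y = r * sin (2 * t0) ->
  omse x y (t, c) =
  omse x y (t0, mean x * sin t0 - mean y * cos t0)
  + ((c - (mean x * sin t - mean y * cos t)) ^+ 2 + r * sin (t - t0) ^+ 2).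
Proof.
move=> n_gt0 uE vE; rewrite !omseE // subrr uE vE.
have -> : r * cos (2 * t0) * cos (2 * t) + r * sin (2 * t0) * sin (2 * t)
    = r * cos (2 * t - 2 * t0) by rewrite cosB; ring.
have -> : r * cos (2 * t0) * cos (2 * t0) + r * sin (2 * t0) * sin (2 * t0)
    = r by rewrite -[RHS]mulr1 -[in RHS](cos2Dsin2 (2 * t0)); ring.
rewrite -mulrBr (mulr_natl (t - t0)) cos_mulr2n -mulr_natl sin2cos2.
by field.
Qed.

Lemma sin_eq0_ltpi (R : realType) (t : R) :
  - pi < t < pi -> sin t = 0 -> t = 0.
Proof.
move=> /andP[t_gt t_lt] sin0; case: (ltgtP t 0) => // [t_lt0|t_gt0].
  have : 0 < sin (- t) by apply: sin_gt0_pi; lra.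
  by rewrite sinN sin0 oppr0 ltxx.
have : 0 < sin t by apply: sin_gt0_pi; lra.
by rewrite sin0 ltxx.
Qed.

Lemma line_paramsP (R : realType) (t c : R) :
  line_params R (t, c) <-> - (pi / 2) < t <= pi / 2.
Proof. by rewrite /line_params /= in_itv /=; split=> [[]|]. Qed.

Lemma omse_unique_min (R : realType) (n : nat) (x y : 'rV[R]_n) (r t0 : R) :
  (0 < n)%N -> 0 < r -> - (pi / 2) < t0 <= pi / 2 ->
  var x - var y = r * cos (2 * t0) -> 2 * cov x y = r * sin (2 * t0) ->
  is_unique_min_on (line_params R) (omse x y)
    (t0, mean x * sin t0 - mean y * cos t0).
Proof.
move=> n_gt0 r_gt0 t0_in uE vE.
pose g (p : R * R) := (p.2 - (mean x * sin p.1 - mean y * cos p.1)) ^+ 2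
  + r * sin (p.1 - t0) ^+ 2.
apply: (@unique_min_on_gap _ _ _ _ g).
- by apply/line_paramsP.
- by move=> [t c] _; apply: omse_gap.
- by move=> [t c] _; rewrite addr_ge0 ?sqr_ge0 // mulr_ge0 ?sqr_ge0 // ltW.
move=> [t c] /line_paramsP t_in /eqP.
rewrite /g /= paddr_eq0 ?sqr_ge0 //; last first.
  by rewrite mulr_ge0 ?sqr_ge0 // ltW.
rewrite sqrf_eq0 mulf_eq0 (gt_eqF r_gt0) /= sqrf_eq0.
move=> /andP[/eqP c_eq /eqP sin0].
have t_eq : t = t0.
  apply/eqP; rewrite -subr_eq0; apply/eqP/sin_eq0_ltpi => //.
  by move: t0_in t_in; lra.
by rewrite -t_eq; congr (_, _); apply/eqP; rewrite -subr_eq0 c_eq.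
Qed.

(** When the polar radius is zero the excess is only the squared offset from
    the centroid, whatever the direction. *)
Lemma omse_min_isotropic (R : realType) (n : nat) (x y : 'rV[R]_n) (t : R) :
  (0 < n)%N -> var x = var y -> cov x y = 0 -> - (pi / 2) < t <= pi / 2 ->
  is_min_on (line_params R) (omse x y) (t, mean x * sin t - mean y * cos t).
Proof.
move=> n_gt0 var_eq cov0 t_in; split; first exact/line_paramsP.
move=> [s c] _; rewrite (@omse_gap _ _ x y 0 t s c) //; last 2 first.
- by rewrite var_eq subrr mul0r.
- by rewrite cov0 mulr0 mul0r.
by rewrite lerDl mul0r addr0 sqr_ge0.
Qed.

Lemma omse_min_centroid (R : realType) (n : nat) (x y : 'rV[R]_n) (t c : R) :
  (0 < n)%N -> is_min_on (line_params R) (omse x y) (t, c) ->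
  c = mean x * sin t - mean y * cos t.
Proof.
move=> n_gt0 [/line_paramsP t_in tc_min].
have := tc_min (t, mean x * sin t - mean y * cos t).
rewrite !omseE // subrr expr0n add0r gerDr => sq_le0.
apply/eqP; rewrite -subr_eq0 -sqrf_eq0 eq_le sqr_ge0 andbT.
by apply: sq_le0; apply/line_paramsP.
Qed.

(** * The polar angle *)

(** [k = 1] and [k = -1] are the half-planes [u > 0] and [u < 0]; in the
    second one [2 t] is off [atan (v / u)] by [pi] in either direction, which
    changes the sign of both coordinates. *)
Lemma polar_atan (R : realType) (u v t k : R) :
  u != 0 -> 0 < k * u ->
  cos (2 * t) = k * cos (atan (v / u)) ->
  sin (2 * t) = k * sin (atan (v / u)) -> k ^+ 2 = 1 ->
  exists r, [/\ 0 < r, u = r * cos (2 * t) & v = r * sin (2 * t)].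
Proof.
move=> u_neq0 ku_gt0 cosE sinE k2.
have cos_gt0 : 0 < cos (atan (v / u)).
  by apply: cos_gt0_pihalf; rewrite atan_gtNpi2 atan_ltpi2.
have cos_neq0 := lt0r_neq0 cos_gt0.
have sin_atan : sin (atan (v / u)) = v / u * cos (atan (v / u)).
  by rewrite -{2}(atanK (v / u)) /tan divfK.
exists (k * u / cos (atan (v / u))); split; first exact: divr_gt0.
  by rewrite cosE; field: k2.
by rewrite sinE sin_atan; field: k2; rewrite u_neq0 cos_neq0.
Qed.

Lemma half_atan_bound (R : realType) (e : R) :
  - (pi / 4) < atan e / 2 < pi / 4.
Proof. by have := atan_gtNpi2 e; have := atan_ltpi2 e; lra. Qed.

(** Halving puts [atan (v / u) / 2] within [pi / 4] of [0].  For [u < 0] it is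
    moved by [pi / 2] upwards or downwards according to the sign of
    [atan (v / u)], opposite to that of [v], so as to stay in the half-open
    interval; at [v = 0] only the upward move does. *)
Lemma polar_half_angle (R : realType) (u v : R) : u != 0 ->
  exists t r : R,
    [/\ 0 < r, - (pi / 2) < t <= pi / 2,
        u = r * cos (2 * t) /\ v = r * sin (2 * t) &
        [/\ 0 < u -> t = atan (v / u) / 2,
            u < 0 -> 0 <= v -> t = atan (v / u) / 2 + pi / 2 &
            u < 0 -> v < 0 -> t = atan (v / u) / 2 - pi / 2]].
Proof.
move=> u_neq0; have pi_gt0 := pi_gt0 R.
have /andP[a_gt a_lt] := half_atan_bound (v / u).
case: (ltgtP u 0) (u_neq0) => // [u_lt0|u_gt0] _; last first.
  have tE : 2 * (atan (v / u) / 2) = atan (v / u) by field.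
  have [| | | |r [r_gt0 uE vE]] :=
      @polar_atan _ u v (atan (v / u) / 2) 1 u_neq0.
  - by rewrite mul1r.
  - by rewrite tE mul1r.
  - by rewrite tE mul1r.
  - by rewrite expr1n.
  by exists (atan (v / u) / 2), r; split=> //; lra.
case: (ltP v 0) => [v_lt0|v_ge0].
  have tE : 2 * (atan (v / u) / 2 - pi / 2) = atan (v / u) - pi by field.
  have [| | | |r [r_gt0 uE vE]] :=
      @polar_atan _ u v (atan (v / u) / 2 - pi / 2) (-1) u_neq0.
  - by rewrite mulN1r oppr_gt0.
  - by rewrite tE cosB cospi sinpi; ring.
  - by rewrite tE sinB cospi sinpi; ring.
  - by rewrite sqrrN expr1n.
  exists (atan (v / u) / 2 - pi / 2), r; split=> //.
  have a_gt0 : 0 < atan (v / u).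
    have vu_gt0 : 0 < v / u by rewrite ltr_ndivlMr // mul0r.
    by rewrite -(atan0 R) lt_atan.
  by lra.
have tE : 2 * (atan (v / u) / 2 + pi / 2) = atan (v / u) + pi by field.
have [| | | |r [r_gt0 uE vE]] :=
    @polar_atan _ u v (atan (v / u) / 2 + pi / 2) (-1) u_neq0.
- by rewrite mulN1r oppr_gt0.
- by rewrite tE cosDpi mulN1r.
- by rewrite tE sinDpi mulN1r.
- by rewrite sqrrN expr1n.
exists (atan (v / u) / 2 + pi / 2), r; split=> //.
have a_le0 : atan (v / u) <= 0.
  have vu_le0 : v / u <= 0 by rewrite ler_ndivrMr // mul0r.
  by rewrite -(atan0 R) le_atan.
by lra.
Qed.

(** For [u = 0] the polar angle is a right angle of the sign of [v]. *)
Lemma omse_unique_min_pi4 (R : realType) (n : nat) (x y : 'rV[R]_n) :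
  (0 < n)%N -> var x = var y -> 0 < cov x y ->
  is_unique_min_on (line_params R) (omse x y)
    (pi / 4, mean x * sin (pi / 4) - mean y * cos (pi / 4)).
Proof.
move=> n_gt0 var_eq cov_gt0; have pi_gt0 := pi_gt0 R.
have tE : 2 * (pi / 4) = pi / 2 :> R by field.
apply: (@omse_unique_min _ _ x y (2 * cov x y)) => //; [lra|lra| |].
  by rewrite tE cos_pihalf mulr0 var_eq subrr.
by rewrite tE sin_pihalf mulr1.
Qed.

Lemma omse_unique_min_Npi4 (R : realType) (n : nat) (x y : 'rV[R]_n) :
  (0 < n)%N -> var x = var y -> cov x y < 0 ->
  is_unique_min_on (line_params R) (omse x y)
    (- (pi / 4), mean x * sin (- (pi / 4)) - mean y * cos (- (pi / 4))).
Proof.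
move=> n_gt0 var_eq cov_lt0; have pi_gt0 := pi_gt0 R.
have tE : 2 * - (pi / 4) = - (pi / 2) :> R by field.
apply: (@omse_unique_min _ _ x y (- (2 * cov x y))) => //; [lra|lra| |].
  by rewrite tE cosN cos_pihalf mulr0 var_eq subrr.
by rewrite tE sinN sin_pihalf; ring.
Qed.

Lemma omse_unique_min_atan (R : realType) (n : nat) (x y : 'rV[R]_n) :
  let E := 2 * cov x y / (var x - var y) in
  (0 < n)%N -> var x != var y ->
  exists t : R,
    [/\ is_unique_min_on (line_params R) (omse x y)
          (t, mean x * sin t - mean y * cos t),
        tan (2 * t) = E,
        var y < var x -> t = atan E / 2,
        var x < var y -> 0 <= cov x y -> t = atan E / 2 + pi / 2 &
        var x < var y -> cov x y < 0 -> t = atan E / 2 - pi / 2].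
Proof.
move=> E n_gt0 var_neq.
have u_neq0 : var x - var y != 0 by rewrite subr_eq0.
have [t [r [r_gt0 t_in [uE vE] [t_pos t_neg_pos t_neg_neg]]]] :=
  polar_half_angle (2 * cov x y) u_neq0.
exists t; split.
- exact: omse_unique_min uE vE.
- have cos_neq0 : cos (2 * t) != 0.
    by apply: contraNneq u_neq0 => cos0; rewrite uE cos0 mulr0.
  by rewrite /tan /E uE vE; field; rewrite cos_neq0 (lt0r_neq0 r_gt0).
- by move=> lt_var; apply: t_pos; lra.
- by move=> lt_var cov_ge0; apply: t_neg_pos; lra.
- by move=> lt_var cov_lt0; apply: t_neg_neg; lra.
Qed.

Lemma omse_min_exists (R : realType) (n : nat) (x y : 'rV[R]_n) :
  (0 < n)%N -> exists p : R * R, is_min_on (line_params R) (omse x y) p.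
Proof.
move=> n_gt0.
have [var_eq|var_neq] := eqVneq (var x) (var y); last first.
  have [t [[t_min _] _ _ _ _]] := omse_unique_min_atan n_gt0 var_neq.
  by eexists; exact: t_min.
case: (ltgtP (cov x y) 0) => [cov_lt0|cov_gt0|cov0].
- have [min _] := omse_unique_min_Npi4 n_gt0 var_eq cov_lt0.
  by eexists; exact: min.
- have [min _] := omse_unique_min_pi4 n_gt0 var_eq cov_gt0.
  by eexists; exact: min.
eexists; apply: (@omse_min_isotropic _ _ x y 0) => //.
by have := pi_gt0 R; lra.
Qed.

(** * Regression coefficients in terms of sums *)

Lemma regression_slope_sums (R : realType) (n : nat) (x y : 'rV[R]_n) :
  (0 < n)%N ->
  cov x y / var x =
  (n%:R * (\sum_(i < n) x 0 i * y 0 i)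
     - (\sum_(i < n) x 0 i) * (\sum_(i < n) y 0 i))
  / (n%:R * (\sum_(i < n) x 0 i ^+ 2) - (\sum_(i < n) x 0 i) ^+ 2).
Proof.
move=> n_gt0; have n_neq0 : n%:R != 0 :> R by rewrite pnatr_eq0 -lt0n.
by rewrite sqr_card_cov // sqr_card_var // -mulf_div divff ?mul1r // expf_neq0.
Qed.

Lemma regression_intercept_means (R : realType) (n : nat) (x y : 'rV[R]_n) :
  mean y * var x - mean x * cov x y
  = mean_sqr x * mean y - mean x * mean_mul x y.
Proof. by rewrite varE /cov; ring. Qed.

Lemma regression_intercept_sums (R : realType) (n : nat) (x y : 'rV[R]_n) :
  (0 < n)%N ->
  (mean y * var x - mean x * cov x y) / var x =
  ((\sum_(i < n) x 0 i ^+ 2) * (\sum_(i < n) y 0 i)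
     - (\sum_(i < n) x 0 i) * (\sum_(i < n) x 0 i * y 0 i))
  / (n%:R * (\sum_(i < n) x 0 i ^+ 2) - (\sum_(i < n) x 0 i) ^+ 2).
Proof.
move=> n_gt0; have n_neq0 : n%:R != 0 :> R by rewrite pnatr_eq0 -lt0n.
rewrite sqr_card_var // regression_intercept_means.
have -> : (\sum_(i < n) x 0 i ^+ 2) * (\sum_(i < n) y 0 i)
     - (\sum_(i < n) x 0 i) * (\sum_(i < n) x 0 i * y 0 i)
  = n%:R ^+ 2 * (mean_sqr x * mean y - mean x * mean_mul x y).
  by rewrite /mean_sqr /mean /mean_mul; field.
by rewrite -mulf_div divff ?mul1r // expf_neq0.
Qed.

Lemma regression_line (R : realType) (n : nat) (x y : 'rV[R]_n) :
  let Sx := \sum_(i < n) x 0 i in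
  let Sy := \sum_(i < n) y 0 i in
  let Sxy := \sum_(i < n) x 0 i * y 0 i in
  let Sxx := \sum_(i < n) x 0 i ^+ 2 in
  (0 < n)%N -> var x != 0 ->
  exists m b : R,
    [/\ is_unique_min_on setT (vmse x y) (m, b),
        m = cov x y / var x /\
        m = (n%:R * Sxy - Sx * Sy) / (n%:R * Sxx - Sx ^+ 2) &
        [/\ b = (mean_sqr x * mean y - mean x * mean_mul x y) / var x,
            b = (mean y * var x - mean x * cov x y) / var x &
            b = (Sxx * Sy - Sx * Sxy) / (n%:R * Sxx - Sx ^+ 2)]].
Proof.
move=> Sx Sy Sxy Sxx n_gt0 vx_neq0.
exists (cov x y / var x), ((mean y * var x - mean x * cov x y) / var x).
split; first exact: vmse_unique_min.
- by split=> //; apply: regression_slope_sums.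
- split=> //; first by rewrite regression_intercept_means.
  exact: regression_intercept_sums.
Qed.

Theorem theorem3p1 (R : realType) (n : nat) (hn : (2 <= n)%N)
    (x y : 'rV[R]_n) :
  let N : R := n%:R in
  let Sx := \sum_(i < n) x 0 i in
  let Sy := \sum_(i < n) y 0 i in
  let Sxy := \sum_(i < n) x 0 i * y 0 i in
  let Sxx := \sum_(i < n) x 0 i ^+ 2 in
  let Syy := \sum_(i < n) y 0 i ^+ 2 in
  (* (a) *)
  (var x != 0 ->
   exists m b : R,
     [/\ is_unique_min_on setT (vmse x y) (m, b),
         m = cov x y / var x /\
         m = (N * Sxy - Sx * Sy) / (N * Sxx - Sx ^+ 2) &
         [/\ b = (mean_sqr x * mean y - mean x * mean_mul x y) / var x,
             b = (mean y * var x - mean x * cov x y) / var x &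
             b = (Sxx * Sy - Sx * Sxy) / (N * Sxx - Sx ^+ 2)]])
  /\
  (* (b) *)
  (var y != 0 ->
   exists mu beta : R,
     [/\ is_unique_min_on setT (hmse x y) (mu, beta),
         mu = cov x y / var y /\
         mu = (N * Sxy - Sx * Sy) / (N * Syy - Sy ^+ 2) &
         [/\ beta = (mean_sqr y * mean x - mean y * mean_mul x y) / var y,
             beta = (mean x * var y - mean y * cov x y) / var y &
             beta = (Syy * Sx - Sy * Sxy) / (N * Syy - Sy ^+ 2)]])
  /\
  (* (c) *)
  let D := omse x y in
  let copt (theta : R) := mean x * sin theta - mean y * cos theta in
  let E := 2 * cov x y / (var x - var y) in
  [/\ (exists p : R * R, is_min_on (line_params R) D p) /\
      (forall theta c : R,
         is_min_on (line_params R) D (theta, c) -> c = copt theta),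
      var x = var y -> cov x y = 0 ->
      forall theta : R, - (pi / 2) < theta <= pi / 2 ->
        is_min_on (line_params R) D (theta, copt theta),
      var x != var y ->
      E = 2 * (N * Sxy - Sx * Sy) / (N * Sxx - Sx ^+ 2 - N * Syy + Sy ^+ 2) /\
      exists theta : R,
        [/\ is_unique_min_on (line_params R) D (theta, copt theta),
            tan (2 * theta) = E,
            var y < var x -> theta = atan E / 2,
            var x < var y -> 0 <= cov x y -> theta = atan E / 2 + pi / 2 &
            var x < var y -> cov x y < 0 -> theta = atan E / 2 - pi / 2] &
      var x = var y ->
      (0 < cov x y ->
         is_unique_min_on (line_params R) D (pi / 4, copt (pi / 4))) /\
      (cov x y < 0 ->
         is_unique_min_on (line_params R) D (- (pi / 4), copt (- (pi / 4))))].
Proof.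
move=> N Sx Sy Sxy Sxx Syy.
have n_gt0 : (0 < n)%N by apply: leq_trans hn.
split; first exact: regression_line.
split.
  (* [hmse x y] unfolds to [vmse y x]. *)
  move=> vy_neq0; have := regression_line x n_gt0 vy_neq0.
  rewrite (covC y x) (mean_mulC y x).
  rewrite (mulrC (\sum_(i < n) y 0 i) (\sum_(i < n) x 0 i)).
  by under [\sum_(i < n) y 0 i * x 0 i]eq_bigr do rewrite mulrC.
move=> D copt E; split.
- split; first exact: omse_min_exists.
  by move=> t c; apply: omse_min_centroid.
- by move=> var_eq cov0 t; apply: omse_min_isotropic.
- move=> var_neq; split; last exact: omse_unique_min_atan.
  have N2_neq0 : N ^+ 2 != 0 by rewrite expf_neq0 // pnatr_eq0 -lt0n.
  have -> : N * Sxx - Sx ^+ 2 - N * Syy + Sy ^+ 2 = N ^+ 2 * (var x - var y).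
    by rewrite mulrBr -!sqr_card_var // -/N -/Sx -/Sy -/Sxx -/Syy; ring.
  by rewrite sqr_card_cov // mulrCA -mulf_div divff // mul1r.
- move=> var_eq; split=> ?; first exact: omse_unique_min_pi4.
  exact: omse_unique_min_Npi4.
Qed.
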